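(* Let $G$ and $H$ be groups, let $A$ be a finite set with $|A|\ge 2$, and let $\phi : H \to G$ be a group homomorphism. A function $\tau : A^G \to A^H$ is a $\phi$-cellular automaton if and only if $\tau$ is continuous and $\phi$-equivariant.
   Context: For a group $G$, $A^G$ is the set of all functions $x : G \to A$, endowed with the prodiscrete topology (the product topology with $A$ discrete) and with the shift action $(g\cdot x)(h) := x(g^{-1}h)$ for $x \in A^G$, $g,h\in G$; likewise for $A^H$. A function $\tau : A^G \to A^H$ is a $\phi$-cellular automaton if there are a finite subset $S \subseteq G$ (a memory set of $\tau$) and a function $\mu : A^S \to A$ (a local function) such that $\tau(x)(h) = \mu((\phi(h^{-1})\cdot x)|_S)$ for all $x \in A^G$, $h \in H$. A function $\tau : A^G \to A^H$ is $\phi$-equivariant if $h \cdot \tau(x) = \tau(\phi(h)\cdot x)$ for all $x \in A^G$, $h \in H$. *)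

(* Defs.v *)
From HB Require Import structures.
From mathcomp Require Import all_boot finmap.
From mathcomp Require Import all_classical topology.

Set Implicit Arguments.
Unset Strict Implicit.
Unset Printing Implicit Defensive.

Local Open Scope group_scope.

(* A^X with the prodiscrete topology; the carrier unfolds to X -> A. *)
Notation config A X := {ptws X -> discrete_topology A}.

Definition shift_act (A : Type) (G : groupType) (g : G) (x : config A G) :
    config A G :=
  fun h => x (g^-1 * h).

Definition restrict (A : Type) (G : groupType) (S : {fset G})
    (x : config A G) : S -> A :=
  fun s => x (val s).

Arguments restrict {A G} S x.

(* Between groups a multiplicative map is a homomorphism: it also preserves 1
   and inverses. *)
Definition has_local_rule (A : Type) (G H : groupType)
    (phi : {multiplicative H -> G}) (tau : config A G -> config A H)
    (S : {fset G}) (mu : (S -> A) -> A) : Prop :=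
  forall (x : config A G) (h : H),
    tau x h = mu (restrict S (shift_act (phi h^-1) x)).

Definition cellular_automaton (A : Type) (G H : groupType)
    (phi : {multiplicative H -> G}) (tau : config A G -> config A H) : Prop :=
  exists (S : {fset G}) (mu : (S -> A) -> A), has_local_rule phi tau mu.

Definition equivariant (A : Type) (G H : groupType)
    (phi : {multiplicative H -> G}) (tau : config A G -> config A H) : Prop :=
  forall (x : config A G) (h : H),
    shift_act h (tau x) = tau (shift_act (phi h) x).

(* Main.v *)
Require Import Defs.
From mathcomp Require Import all_boot finmap.
From mathcomp Require Import all_classical topology.

(** Everything rests on the fact that in the prodiscrete topology the cylinders
    [{y | y = x on S}], [S] finite, form a basis of neighbourhoods of [x]
    ([prodiscrete_nbhsP]).

    If [tau] has a local rule with memory set [S], then each coordinate of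
    [tau x] is determined by the values of [x] on a finite translate of [S], so
    [tau] is continuous; equivariance is a computation in the group.

    Conversely, equivariance gives [tau x h = tau (phi h^-1 . x) 1], so that
    [tau] is determined by the single function [x |-> tau x 1].  By continuity
    the value of this function at [x] depends only on the restriction of [x] to
    a finite set, which may vary with [x].  Since the alphabet is finite, the
    configuration space is compact by Tychonoff's theorem, and one finite set
    serves all configurations ([compact_finite_dependence]): that is the memory
    set. *)

Set Implicit Arguments.
Unset Strict Implicit.
Unset Printing Implicit Defensive.

Local Open Scope classical_set_scope.
Local Open Scope group_scope.

Lemma prodiscrete_cvgP (X : Type) (A : choiceType)
    (F : set_system (config A X)) (x : config A X) :
  Filter F -> F --> x <-> forall i, F [set y : config A X | y i = x i].
Proof.
move=> FF; split=> [/cvg_sup Fx i|Fx].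
  apply: (Fx i); rewrite nbhsE /=.
  exists [set y : config A X | y i = x i] => //; split=> //.
  exists [set x i] => //.
  exact: (@discrete_open (discrete_topology A)).
apply/cvg_sup => i U; rewrite nbhsE => -[_ [[C _ <-] /= Cxi] sCU].
by apply: filterS (Fx i) => y /= yxi; apply: sCU; rewrite /= yxi.
Qed.

(** The cylinders around [x] generate a filter that converges to [x] in every
    coordinate, hence converges to [x]; this says that every neighbourhood of
    [x] contains a cylinder. *)
Lemma prodiscrete_nbhsP (X A : choiceType) (x : config A X)
    (U : set (config A X)) :
  nbhs x U <->
  exists S : {fset X}, forall y : config A X, {in S, y =1 x} -> U y.
Proof.
pose cylinder (S : {fset X}) := [set y : config A X | {in S, y =1 x}].
split=> [|[S sSU]].
  have cylF : Filter (filter_from [set: {fset X}] cylinder).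
    apply: filter_from_filter => [|S T _ _]; first by exists fset0.
    exists (S `|` T)%fset => // y yx.
    by split=> i iS; apply: yx; rewrite inE iS ?orbT.
  have /prodiscrete_cvgP cyl_cvg i :
      filter_from [set: {fset X}] cylinder [set y : config A X | y i = x i].
    by exists [fset i]%fset => // y; apply; rewrite inE.
  by move=> /cyl_cvg[S _ sSU]; exists S.
have /prodiscrete_cvgP coord_near : nbhs x --> x by exact: cvg_id.
have : nbhs x (\bigcap_(i in [set` S]) [set y : config A X | y i = x i]).
  by apply: filter_bigI => i _; exact: coord_near.
apply: filterS => y yx.
by apply: sSU => i iS; exact: yx.
Qed.

Lemma prodiscrete_continuousP (X Y A : choiceType)
    (f : config A X -> config A Y) :
  continuous f <-> forall x i, \forall y \near x, f y i = f x i.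
Proof.
by split=> f_cont x;
  apply/(prodiscrete_cvgP _ (fmap_filter f (nbhs_filter x))); exact: f_cont.
Qed.

Lemma prodiscrete_compact (X : eqType) (A : finType) :
  compact [set: config A X].
Proof.
have cptA : compact [set: discrete_topology A].
  exact/finite_compact/(@finite_finset A).
rewrite (_ : setT = [set x : config A X | forall i, [set: A] (x i)]).
  exact: (@tychonoff X (fun=> discrete_topology A) (fun=> setT)).
by apply/seteqP; split.
Qed.

(** The statement to be proved holds locally for all large enough finite sets:
    if [S] witnesses finite dependence at [x], then so does every superset of
    [S] at every point of the cylinder around [x] over [S].  Compactness, in
    near-covering form along the filter of large finite sets, makes it hold
    everywhere for one finite set. *)
Lemma compact_finite_dependence (X A : choiceType) (B : Type)
    (f : config A X -> B) :
    compact [set: config A X] ->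
    (forall x, \forall y \near x, f y = f x) ->
  exists S : {fset X}, forall x y : config A X, {in S, y =1 x} -> f y = f x.
Proof.
move=> /compact_near_coveringP cptX f_loc.
pose large := filter_from [set: {fset X}] (fun S => [set T | S `<=` T]%fset).
have largeF : ProperFilter large.
  apply: filter_from_proper => [|S _]; last by exists S => /=.
  apply: filter_from_filter => [|S T _ _]; first by exists fset0.
  by exists (S `|` T)%fset => // V /=; rewrite fsubUset => /andP[].
pose depends (S : {fset X}) (x : config A X) :=
  forall y : config A X, {in S, y =1 x} -> f y = f x.
have [x _|S dependsS] := filter_ex (cptX _ large depends _ _); last first.
  by exists S => x; exact: dependsS.
have /prodiscrete_nbhsP[S fS] := f_loc x.
exists ([set z : config A X | {in S, z =1 x}], [set T | S `<=` T]%fset).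
  by split; [apply/prodiscrete_nbhsP; exists S | exists S].
move=> [z T] /= [zx /fsubsetP sST] y yz.
by rewrite !fS// => i iS; rewrite yz ?sST// zx.
Qed.

Section CellularAutomata.
Variables (G H : groupType) (A : finType) (phi : {multiplicative H -> G}).
Variable tau : config A G -> config A H.

Lemma cellular_automaton_continuous :
  cellular_automaton phi tau -> continuous tau.
Proof.
move=> [S [mu tauE]]; apply/prodiscrete_continuousP => x h.
apply/prodiscrete_nbhsP.
exists [fset (phi h^-1)^-1 * s | s in S]%fset => y yx /=.
rewrite !tauE; congr mu; apply/funext => s.
by apply: yx; apply/imfsetP; exists (val s) => //; exact: valP.
Qed.

Lemma cellular_automaton_equivariant :
  cellular_automaton phi tau -> equivariant phi tau.
Proof.
move=> [S [mu tauE]] x h; apply/funext => k.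
rewrite /shift_act !tauE; congr mu; apply/funext => s.
by rewrite /Defs.restrict /shift_act invgM invgK gmulfM invgM mulgA.
Qed.

Lemma equivariant_at1 x h :
  equivariant phi tau -> tau x h = tau (shift_act (phi h^-1) x) 1.
Proof. by move=> <-; rewrite /shift_act invgK mulg1. Qed.

(** A pattern on the memory set is evaluated by extending it to a configuration
    and reading [tau] at [1]; the choice of the extension is immaterial, because
    [S] determines that value. *)
Lemma finite_dependence_cellular_automaton (S : {fset G}) :
    equivariant phi tau ->
    (forall x y : config A G, {in S, y =1 x} -> tau y 1 = tau x 1) ->
  inhabited A -> cellular_automaton phi tau.
Proof.
move=> tau_eq tauS [a0].
pose extend (p : S -> A) : config A G := fun g => oapp p a0 (insub g).
exists S, (fun p => tau (extend p) 1) => x h.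
rewrite equivariant_at1//; apply: tauS => g gS.
by rewrite /extend insubT.
Qed.

End CellularAutomata.

Theorem theorem1 (G H : groupType) (A : finType) (cardA : (2 <= #|A|)%N)
    (phi : {multiplicative H -> G}) (tau : config A G -> config A H) :
  cellular_automaton phi tau <-> continuous tau /\ equivariant phi tau.
Proof.
split=> [tau_ca|[tau_cont tau_eq]].
  split; first exact: cellular_automaton_continuous tau_ca.
  exact: cellular_automaton_equivariant.
have tau1_loc (x : config A G) : \forall y \near x, tau y 1 = tau x 1.
  by move/prodiscrete_continuousP: tau_cont.
have [S tauS] := compact_finite_dependence (@prodiscrete_compact G A) tau1_loc.
apply: finite_dependence_cellular_automaton tau_eq tauS _.
by have /card_gt0P[a _] : (0 < #|A|)%N by exact: ltnW.
Qed.
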